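(* For every $n\ge 1$, $|\mathcal{DRS}_n(231)|=|\mathcal{DRS}_n(312)|=|\mathcal{RS}_n(312)|=2^{n-1}$.
   Context: For $\sigma\in\mathfrak{S}_n$, a double descent is an index $i$ with $\sigma_i>\sigma_{i+1}>\sigma_{i+2}$. The permutation $\sigma$ is simsun if for every $k$, the subword of $\sigma$ consisting of the letters in $\{1,\dots,k\}$ (in the order they appear in $\sigma$) has no double descent. For $\omega\in\mathfrak{S}_t$, $\sigma$ contains an $\omega$-pattern if there are indices $i_1<\cdots<i_t$ with $\sigma_{i_j}<\sigma_{i_k}$ iff $\omega_j<\omega_k$; otherwise $\sigma$ avoids $\omega$. $\mathcal{RS}_n(\omega)$ is the set of $\omega$-avoiding simsun permutations in $\mathfrak{S}_n$, and $\mathcal{DRS}_n(\omega)$ is the set of $\sigma\in\mathcal{RS}_n(\omega)$ such that $\sigma^{-1}$ is simsun. *)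

(* Defs.v *)
From mathcomp Require Import all_boot all_fingroup.

Set Implicit Arguments.
Unset Strict Implicit.
Unset Printing Implicit Defensive.

(* sigma_1 ... sigma_n with letters in {1, ..., n}, whereas the elements of
   'S_n permute 'I_n = {0, ..., n-1}. *)
Definition one_line n (s : 'S_n) : seq nat :=
  [seq (nat_of_ord (s i)).+1 | i <- enum 'I_n].

Definition double_descent (w : seq nat) (i : nat) : bool :=
  [&& i.+2 < size w, nth 0 w i.+1 < nth 0 w i & nth 0 w i.+2 < nth 0 w i.+1].

Definition simsun n (s : 'S_n) : Prop :=
  forall k i : nat, ~~ double_descent [seq a <- one_line s | a <= k] i.

Definition simsunb n (s : 'S_n) : bool :=
  [forall k : 'I_n.+1, forall i : 'I_n,
     ~~ double_descent [seq a <- one_line s | a <= k] i].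

(* Only k <= n and i < n matter: larger k select the whole word, and larger i
   are out of range. *)
Lemma simsunP n (s : 'S_n) : reflect (simsun s) (simsunb s).
Proof.
apply: (iffP 'forall_forallP) => [H k i|H k i]; last exact: H.
have [lt_in|le_ni] := ltnP i n; last first.
  apply/negP=> /and3P[lt_i _ _].
  have := leq_trans lt_i (size_subseq (filter_subseq _ _)).
  rewrite size_map size_enum_ord => /ltnW/ltnW.
  by rewrite ltnNge le_ni.
have -> : [seq a <- one_line s | a <= k]
        = [seq a <- one_line s | a <= Ordinal (n:=n.+1) (geq_minr k n)].
  apply: eq_in_filter => _ /mapP[j _ ->] /=.
  by rewrite leq_min ltn_ord andbT.
exact: (H _ (Ordinal lt_in)).
Qed.

Definition contains_pattern t n (w : 'S_t) (s : 'S_n) : bool :=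
  [exists f : {ffun 'I_t -> 'I_n},
     [forall j : 'I_t, forall k : 'I_t, (j < k) ==> (f j < f k)] &&
     [forall j : 'I_t, forall k : 'I_t, (s (f j) < s (f k)) == (w j < w k)]].

Definition RS n t (w : 'S_t) : {set 'S_n} :=
  [set s : 'S_n | simsunb s & ~~ contains_pattern w s].

Definition DRS n t (w : 'S_t) : {set 'S_n} :=
  [set s in RS n w | simsunb (s^-1)%g].

Definition fun231 (i : 'I_3) : 'I_3 := inord (nth 0 [:: 1; 2; 0] i).
Definition fun312 (i : 'I_3) : 'I_3 := inord (nth 0 [:: 2; 0; 1] i).

Lemma fun231_inj : injective fun231.
Proof.
by case=> [[|[|[|?]]] ?] [[|[|[|?]]] ?] // /(congr1 val) /=;
  rewrite !inordK // => _; apply: val_inj.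
Qed.

Lemma fun312_inj : injective fun312.
Proof.
by case=> [[|[|[|?]]] ?] [[|[|[|?]]] ?] // /(congr1 val) /=;
  rewrite !inordK // => _; apply: val_inj.
Qed.

Definition p231 : 'S_3 := perm fun231_inj.
Definition p312 : 'S_3 := perm fun312_inj.

Lemma one_line_p231 : one_line p231 = [:: 2; 3; 1].
Proof. by rewrite /one_line !enum_ordSl enum_ord0 /= !permE /= !inordK. Qed.

Lemma one_line_p312 : one_line p312 = [:: 3; 1; 2].
Proof. by rewrite /one_line !enum_ordSl enum_ord0 /= !permE /= !inordK. Qed.

(* Main.v *)
Require Import Defs.
From mathcomp Require Import all_boot all_fingroup.

Set Implicit Arguments.
Unset Strict Implicit.
Unset Printing Implicit Defensive.

(* A permutation is simsun and avoids 312 iff it avoids 312 and 321, i.e. iff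
   every letter is followed by at most one smaller letter.  Avoiding 321 is
   invariant under inversion and implies simsun, so RS_n(312) = DRS_n(312); as
   231 is the inverse of 312, inversion maps DRS_n(231) onto DRS_n(312).
   Finally, removing the first letter, which must be one of the two smallest,
   shows that the number of such permutations doubles at each step. *)

Lemma p231V : (p231^-1)%g = p312.
Proof.
apply/permP => x; apply: (canLR (permK p231)); apply: val_inj.
by case: x => [[|[|[|?]]] ?] //; rewrite !permE /= inordK //= inordK.
Qed.

Lemma contains_patternV t n (w : 'S_t) (s : 'S_n) :
  contains_pattern w s -> contains_pattern (w^-1)%g (s^-1)%g.
Proof.
case/existsP=> f /andP[/'forall_forallP f_incr /'forall_forallP f_pat].
have f_lt a b : (f a < f b) = (a < b).
  apply/idP/idP => [|lt_ab]; last exact: (implyP (f_incr a b)).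
  apply: contraTT; rewrite -!leqNgt leq_eqVlt => /predU1P[/val_inj-> //|lt_ba].
  exact: ltnW (implyP (f_incr b a) lt_ba).
(* The values of the occurrence in increasing order: the [j]-th smallest is taken where the pattern
   has the letter [j]. *)
apply/existsP; exists [ffun j => s (f ((w^-1)%g j))].
apply/andP; split; apply/'forall_forallP => j k; rewrite !ffunE.
  by apply/implyP; rewrite (eqP (f_pat _ _)) !permKV.
by rewrite !permK f_lt.
Qed.

Lemma contains_p231V n (s : 'S_n) :
  contains_pattern p231 s = contains_pattern p312 (s^-1)%g.
Proof.
apply/idP/idP => /contains_patternV; first by rewrite p231V.
by rewrite invgK -p231V invgK.
Qed.

Lemma contains_p312P n (s : 'S_n) :
  reflect (exists i j k : 'I_n, [/\ i < j, j < k, s j < s k & s k < s i])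
          (contains_pattern p312 s).
Proof.
apply: (iffP existsP) => [[f /andP[/'forall_forallP incr /'forall_forallP pat]]|].
  pose a := @Ordinal 3 0 isT; pose b := @Ordinal 3 1 isT.
  pose c := @Ordinal 3 2 isT.
  exists (f a), (f b), (f c); split; try exact: (implyP (incr _ _)).
    by rewrite (eqP (pat _ _)) !permE /= !inordK.
  by rewrite (eqP (pat _ _)) !permE /= !inordK.
case=> i [j [k [ij jk sjk ski]]].
have ik := ltn_trans ij jk; have sji := ltn_trans sjk ski.
exists [ffun x : 'I_3 => nth i [:: i; j; k] x].
apply/andP; split; apply/'forall_forallP.
  by case=> [[|[|[|?]]] ?] [[|[|[|?]]] ?] //; rewrite !ffunE.
case=> [[|[|[|?]]] ?] [[|[|[|?]]] ?] //; rewrite !ffunE !permE /= !inordK //=;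
  by rewrite ?ltnn ?sjk ?ski ?sji // ltnNge ltnW.
Qed.

Definition smaller_after n (s : 'S_n) (i : 'I_n) : {set 'I_n} :=
  [set j : 'I_n | (i < j) && (s j < s i)].

(** Avoidance of 312 and 321 at once: in both patterns the first letter precedes two smaller
    ones. *)
Definition le1_smaller_after n (s : 'S_n) : bool :=
  [forall i, #|smaller_after s i| <= 1].

Lemma le1_smaller_afterP n (s : 'S_n) :
  reflect (forall i j k : 'I_n,
             i < j -> j < k -> s j < s i -> s k < s i -> False)
          (le1_smaller_after s).
Proof.
apply: (iffP forallP) => [H i j k ij jk sji ski | H i].
  have /card_le1_eqP/(_ j k) := H i.
  rewrite !inE ij sji (ltn_trans ij jk) ski => /(_ isT isT) ejk.
  by rewrite ejk ltnn in jk.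
apply/card_le1_eqP => j k; rewrite !inE => /andP[ij sji] /andP[ik ski].
by case: (ltngtP j k) => [jk|kj|/val_inj//];
  [case: (H i j k) | case: (H i k j)].
Qed.

Lemma filter_one_line n (s : 'S_n) k :
  [seq a <- one_line s | a <= k] =
  [seq (nat_of_ord (s i)).+1 | i <- enum 'I_n & s i < k].
Proof. by rewrite /one_line filter_map. Qed.

Lemma relpre_ltn_trans n : transitive (relpre (val : 'I_n -> nat) ltn).
Proof. by move=> x y z /=; exact: ltn_trans. Qed.

Lemma enum_filter_sorted n (a : pred 'I_n) :
  sorted (relpre val ltn) [seq i <- enum 'I_n | a i].
Proof.
apply: sorted_filter; first exact: relpre_ltn_trans.
by rewrite -sorted_map val_enum_ord iota_ltn_sorted.
Qed.

Lemma double_descent_map n (s : 'S_n) (x0 : 'I_n) (e : seq 'I_n) i :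
  double_descent [seq (nat_of_ord (s j)).+1 | j <- e] i =
  [&& i.+2 < size e, s (nth x0 e i.+1) < s (nth x0 e i)
    & s (nth x0 e i.+2) < s (nth x0 e i.+1)].
Proof.
rewrite /double_descent size_map; case: ltnP => //= lt_i.
by rewrite !(nth_map x0) // ltnW // ltnW.
Qed.

(** The letters of a restricted word come from increasing positions of [s], so a double descent in
    it is an occurrence of 321 in [s]. *)
Lemma avoid321_simsun n (s : 'S_n) :
  (forall i j k : 'I_n, i < j -> j < k -> s j < s i -> s k < s j -> False) ->
  simsunb s.
Proof.
move=> H; apply/simsunP => k i; rewrite filter_one_line.
(* A double descent forces [n] to be positive, which supplies a default position for [nth]. *)
apply/negP => dd; have x0 : 'I_n.
  case: n s H dd => [|n] s H; last by move=> _; exact: ord0.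
  by rewrite enum_ord0 /double_descent /=.
move: dd; rewrite (double_descent_map _ x0) => /and3P[lt_i d1 d2].
have lt_nth := sorted_ltn_nth (@relpre_ltn_trans n) x0
  (enum_filter_sorted (fun j => s j < k)).
by apply: H d1 d2; apply: lt_nth;
  rewrite ?inE //; [exact: ltnW (ltnW lt_i) | exact: ltnW | exact: ltnW].
Qed.

(* Avoiding 312 makes the letters below [s i] that follow it decrease, so two
   of them give a double descent in the restriction to the letters up to
   [s i]. *)
Lemma simsun_avoid312 n (s : 'S_n) :
  simsunb s -> ~~ contains_pattern p312 s -> le1_smaller_after s.
Proof.
move=> /simsunP ss /contains_p312P av.
apply/le1_smaller_afterP => i j k ij jk sji ski.
(* Letters are shifted by one, so this restriction keeps the values up to [s i], which becomes the
   largest letter. *)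
have := ss (s i).+1; rewrite filter_one_line.
set e := [seq _ <- _ | _] => nodd.
have tr := @relpre_ltn_trans n.
have e_sorted : sorted (relpre val ltn) e by exact: enum_filter_sorted.
have lt_nth := sorted_ltn_nth tr i e_sorted.
have mem_e x : (x \in e) = (s x <= s i).
  by rewrite mem_filter mem_enum andbT.
have [ei ej ek] : [/\ i \in e, j \in e & k \in e].
  by rewrite !mem_e leqnn ltnW // ltnW.
have lt_index x y : x \in e -> y \in e -> x < y -> index x e < index y e.
  move=> ex ey xy; case: ltngtP => // [lt_yx|eq_xy].
    have := sorted_ltn_index tr e_sorted _ _ ey ex lt_yx.
    by rewrite /= ltnNge ltnW.
  by move: xy; rewrite -(nth_index i ex) eq_xy nth_index ?ltnn.
have i2 : (index i e).+2 < size e.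
  apply: leq_ltn_trans (_ : index k e < _); last by rewrite index_mem.
  exact: leq_ltn_trans (lt_index _ _ ei ej ij) (lt_index _ _ ej ek jk).
have i1 := ltnW i2.
set m := index i e in i1 i2 *.
have em : nth i e m = i by exact: nth_index.
have after l : m < l -> l < size e -> i < nth i e l /\ s (nth i e l) < s i.
  move=> ml le; have lti : i < nth i e l.
    by have := lt_nth m l; rewrite em; apply=> //; exact: ltnW i1.
  split=> //; have := mem_nth i le; rewrite mem_e leq_eqVlt => /predU1P[|//].
  by move/val_inj/perm_inj=> eil; rewrite eil ltnn in lti.
have [p1 v1] := after _ (ltnSn m) i1.
have [p2 v2] := after m.+2 (leqnSn _) i2.
have p12 : nth i e m.+1 < nth i e m.+2 by apply: lt_nth.
(* The first descent is [v1]. An ascent in the second place would give a 312 starting at [i]. *)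
have /negP := nodd m; apply; rewrite (double_descent_map _ i) i2 em v1 /=.
rewrite ltnNge leq_eqVlt; apply/negP => /predU1P[/val_inj/perm_inj eq12|v12].
  by rewrite eq12 ltnn in p12.
by apply: av; exists i, (nth i e m.+1), (nth i e m.+2).
Qed.

Lemma mem_RS312 n (s : 'S_n) : (s \in RS n p312) = le1_smaller_after s.
Proof.
rewrite inE; apply/andP/idP => [[]|/le1_smaller_afterP H].
  exact: simsun_avoid312.
split; first by apply: avoid321_simsun => i j k ij jk sji skj;
  exact: H ij jk sji (ltn_trans skj sji).
apply/contains_p312P => -[i [j [k [ij jk sjk ski]]]].
exact: H ij jk (ltn_trans sjk ski) ski.
Qed.

Lemma DRS312 n : DRS n p312 = RS n p312.
Proof.
apply/setP => s; rewrite inE andb_idr // mem_RS312 => /le1_smaller_afterP H.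
apply: avoid321_simsun => i j k ij jk sji skj.
(* A 321 in the inverse at [i], [j], [k] is a 321 in [s] whose letters are [k], [j], [i], in this
   order. *)
by apply: (H _ _ _ skj sji); rewrite !permKV // (ltn_trans ij jk).
Qed.

Lemma card_DRS231 n : #|DRS n p231| = #|DRS n p312|.
Proof.
rewrite -(card_imset _ (@invg_inj 'S_n)); congr #|pred_of_set _|.
apply/setP => s; rewrite -[s in LHS]invgK (mem_imset _ _ (@invg_inj _)).
by rewrite !inE contains_p231V invgK [LHS]andbC andbCA andbC.
Qed.

(** Here [t] is obtained by deleting the first letter of [s] and closing the gap left among the
    values. *)
Lemma lift_perm0_surj n (s : 'S_n.+1) :
  exists t : 'S_n, s = lift_perm ord0 (s ord0) t.
Proof.
have neq k : s ord0 != s (lift ord0 k).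
  by rewrite (inj_eq perm_inj) neq_lift.
pose f k := sval (unlift_some (neq k)).
have fE k : s (lift ord0 k) = lift (s ord0) (f k).
  by rewrite /f; case: unlift_some.
have f_inj : injective f.
  move=> x y exy; apply: (@lift_inj _ ord0); apply: (@perm_inj _ s).
  by rewrite !fE exy.
exists (perm f_inj); apply/permP => x.
case: (unliftP ord0 x) => [k ->|->]; last by rewrite lift_perm_id.
by rewrite lift_perm_lift permE.
Qed.

Lemma ltn_lift n (h : 'I_n.+1) (i j : 'I_n) : (lift h i < lift h j) = (i < j).
Proof. by rewrite !ltnNge /= leq_bump2. Qed.

Lemma smaller_after_lift n (h : 'I_n.+1) (t : 'S_n) i :
  smaller_after (lift_perm ord0 h t) (lift ord0 i) =
  lift ord0 @: smaller_after t i.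
Proof.
apply/setP => x; case: (unliftP ord0 x) => [k ->|->].
  rewrite mem_imset; last exact: lift_inj.
  by rewrite !inE !lift_perm_lift !ltn_lift.
rewrite inE /=; apply/esym/negbTE/imsetP => -[k _ /eqP].
by rewrite (negbTE (neq_lift _ _)).
Qed.

(** Every letter below the first one comes after it, and with values counted from 0 there are
    [s ord0] of them. *)
Lemma card_smaller_after0 n (s : 'S_n.+1) :
  #|smaller_after s ord0| = s ord0.
Proof.
rewrite -(card_imset _ (@perm_inj _ s)).
have -> : s @: smaller_after s ord0 = [set j : 'I_n.+1 | j < s ord0].
  apply/setP => x; rewrite -[x](permKV s) mem_imset; last exact: perm_inj.
  rewrite !inE; case: (unliftP ord0 ((s^-1)%g x)) => [k ->//|->].
  by rewrite !ltnn.
rewrite cardsE -sum1_card (big_ord_narrow (ltnW (ltn_ord (s ord0)))).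
by rewrite sum1_card card_ord.
Qed.

(** The condition at a later position looks only to its right and only at relative order, so a new
    first letter leaves it unchanged. At the first position it bounds [h] itself. *)
Lemma le1_smaller_after_lift n (h : 'I_n.+1) (t : 'S_n) :
  le1_smaller_after (lift_perm ord0 h t) = (h <= 1) && le1_smaller_after t.
Proof.
apply/forallP/andP => [H | [h1 /forallP H] i].
  split; first by have := H ord0; rewrite card_smaller_after0 lift_perm_id.
  apply/forallP => i; have := H (lift ord0 i).
  by rewrite smaller_after_lift card_imset //; exact: lift_inj.
case: (unliftP ord0 i) => [k ->|->].
  by rewrite smaller_after_lift card_imset //; exact: lift_inj.
by rewrite card_smaller_after0 lift_perm_id.
Qed.

Lemma card_le1_smaller_after n :
  #|[set s : 'S_n.+1 | le1_smaller_after s]| = 2 ^ n.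
Proof.
elim: n => [|n IHn].
  rewrite -[2 ^ 0]/(1`!) -card_Sn cardsE; apply: eq_card => s; rewrite !inE.
  by apply/forallP => i; rewrite (leq_trans (max_card _)) ?card_ord.
(* The boolean chooses which of the two smallest values, 0 or 1, is put in front. *)
pose F (x : bool * 'S_n.+1) := lift_perm ord0 (inord x.1 : 'I_n.+2) x.2.
have F_inj : injective F.
  case=> b t [c u] eF.
  have /(congr1 val) : F (b, t) ord0 = F (c, u) ord0 by rewrite eF.
  rewrite /F !lift_perm_id /= !inordK ?(leq_ltn_trans (leq_b1 _)) //.
  move=> ebc; have {}ebc : b = c by move: ebc; case: (b); case: (c).
  rewrite ebc in eF *.
  congr (_, _); apply/permP => k; apply: (@lift_inj _ (inord c : 'I_n.+2)).
  by rewrite -!(lift_perm_lift ord0) -[LHS]/(F (c, t) _) eF.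
rewrite expnS -IHn -card_bool -cardsT -cardsX -(card_imset _ F_inj).
congr #|pred_of_set _|; apply/setP => s; rewrite inE.
apply/idP/imsetP => [|[[b t]]].
  have [t ->] := lift_perm0_surj s; set h := s ord0.
  rewrite le1_smaller_after_lift => /andP[h1 Ht].
  exists ((h : nat) == 1, t); rewrite ?inE //= /F /=; congr (lift_perm _ _ _).
  apply: val_inj; rewrite /= inordK; last by case: eqP.
  by case: (h : nat) h1 => [|[]].
rewrite !inE /= => Ht ->; rewrite le1_smaller_after_lift Ht andbT.
by rewrite /= inordK; case: b.
Qed.

Theorem theorem4p5 (n : nat) (hn : 1 <= n) :
  [/\ #|DRS n p231| = 2 ^ (n - 1),
      #|DRS n p312| = 2 ^ (n - 1) &
      #|RS n p312| = 2 ^ (n - 1)].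
Proof.
have card_RS : #|RS n p312| = 2 ^ (n - 1).
  case: n hn => // n _; rewrite subn1 -card_le1_smaller_after.
  by apply: eq_card => s; rewrite mem_RS312 inE.
by rewrite card_DRS231 DRS312.
Qed.
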